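(* Let $N$ and $N'$ be fuzzy negations, let $\mathcal{GO}$ be a bivariate general overlap function and let $G$ be a grouping function such that $I_{\mathcal{GO}}^{N}=I_{G,N'}$, i.e. $N(\mathcal{GO}(x,N(y)))=G(N'(x),y)$ for all $x,y\in[0,1]$. (i) If $N$ is strict and $N'$ is frontier, then $\mathcal{GO}$ is an overlap function. (ii) If $1$ is the neutral element of $\mathcal{GO}$, then: (a) if $N$ is a strong negation, then $N=N'$; (b) if $N$ is continuous and $N=N'$, then $N$ is strong; (c) $N$ is strong if and only if $0$ is the neutral element of $G$. (iii) If $0$ is the neutral element of $G$, then: (a) $N'$ is strong if and only if $N'=N$; (b) $N'$ is strong if and only if $1$ is the neutral element of $\mathcal{GO}$.
   Context: A fuzzy negation is a map $N:[0,1]\to[0,1]$ with $N(0)=1$, $N(1)=0$ and $N(x)\le N(y)$ whenever $y\le x$. It is strict if it is continuous and $N(x)<N(y)$ whenever $y<x$; strong if $N(N(x))=x$ for all $x\in[0,1]$; frontier if, for $x\in[0,1]$, $N(x)\in\{0,1\}$ if and only if $x=0$ or $x=1$. A bivariate general overlap function is a function $\mathcal{GO}:[0,1]^2\to[0,1]$ such that for all $x,y\in[0,1]$: (1) $\mathcal{GO}(x,y)=\mathcal{GO}(y,x)$; (2) if $xy=0$ then $\mathcal{GO}(x,y)=0$; (3) if $xy=1$ then $\mathcal{GO}(x,y)=1$; (4) $\mathcal{GO}$ is increasing (in the non-strict sense) in each variable; (5) $\mathcal{GO}$ is continuous. An overlap function is a function $O:[0,1]^2\to[0,1]$ that is commutative,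 continuous, increasing (in the non-strict sense) in each variable, and satisfies $O(x,y)=0$ if and only if $x=0$ or $y=0$, and $O(x,y)=1$ if and only if $x=y=1$. A grouping function is a function $G:[0,1]^2\to[0,1]$ that is commutative, continuous, increasing (in the non-strict sense) in each variable, and satisfies $G(x,y)=0$ if and only if $x=y=0$, and $G(x,y)=1$ if and only if $x=1$ or $y=1$. An element $a\in[0,1]$ is a neutral element of a commutative $F:[0,1]^2\to[0,1]$ if $F(x,a)=x$ for all $x\in[0,1]$. Notation: $I_{\mathcal{GO}}^{N}(x,y)=N(\mathcal{GO}(x,N(y)))$ and $I_{G,N'}(x,y)=G(N'(x),y)$. *)

(* Defs.v *)
From mathcomp Require Import all_boot all_order all_algebra.
From mathcomp Require Import all_classical all_reals all_analysis.
Set Implicit Arguments.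
Unset Strict Implicit.
Unset Printing Implicit Defensive.
Import Order.TTheory GRing.Theory Num.Theory.
Import numFieldNormedType.Exports.
Local Open Scope classical_set_scope.
Local Open Scope ring_scope.

(* Used as a type, [unit_itv R] is [set_type (unit_itv R)], which carries the
   subspace topology; pairs carry the product topology, so [continuous F] below
   is joint continuity on [0,1]^2. *)
Definition unit_itv (R : realType) : set R := `[0, 1]%classic.
Arguments unit_itv : clear implicits.

Definition uval (R : realType) (x : unit_itv R) : R := set_val x.

Lemma unit_itv0_subproof (R : realType) : (0 : R) \in unit_itv R.
Proof. by rewrite inE /unit_itv /= in_itv /= lexx ler01. Qed.

Lemma unit_itv1_subproof (R : realType) : (1 : R) \in unit_itv R.
Proof. by rewrite inE /unit_itv /= in_itv /= ler01 lexx. Qed.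

Definition u0 (R : realType) : unit_itv R := SigSub (unit_itv0_subproof R).
Definition u1 (R : realType) : unit_itv R := SigSub (unit_itv1_subproof R).
Arguments u0 {R}.
Arguments u1 {R}.

Section FuzzyConnectives.
Variable R : realType.
Local Notation I := (unit_itv R).
Implicit Types (N : I -> I) (F : I * I -> I).

Definition fuzzy_negation N : Prop :=
  [/\ N u0 = u1, N u1 = u0 &
      forall x y : I, uval y <= uval x -> uval (N x) <= uval (N y)].

Definition strict_negation N : Prop :=
  continuous N /\
  (forall x y : I, uval y < uval x -> uval (N x) < uval (N y)).

Definition strong_negation N : Prop := forall x : I, N (N x) = x.

Definition frontier_negation N : Prop :=
  forall x : I, (N x = u0 \/ N x = u1) <-> (x = u0 \/ x = u1).

Definition commutative2 F : Prop := forall x y : I, F (x, y) = F (y, x).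

Definition increasing2 F : Prop :=
  (forall x x' y : I, uval x <= uval x' -> uval (F (x, y)) <= uval (F (x', y)))
  /\
  (forall x y y' : I, uval y <= uval y' -> uval (F (x, y)) <= uval (F (x, y'))).

Definition general_overlap F : Prop :=
  [/\ commutative2 F,
      forall x y : I, uval x * uval y = 0 -> F (x, y) = u0,
      forall x y : I, uval x * uval y = 1 -> F (x, y) = u1,
      increasing2 F &
      continuous F].

Definition overlap F : Prop :=
  [/\ commutative2 F,
      continuous F,
      increasing2 F,
      forall x y : I, F (x, y) = u0 <-> (x = u0 \/ y = u0) &
      forall x y : I, F (x, y) = u1 <-> (x = u1 /\ y = u1)].

Definition grouping F : Prop :=
  [/\ commutative2 F,
      continuous F,
      increasing2 F,
      forall x y : I, F (x, y) = u0 <-> (x = u0 /\ y = u0) &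
      forall x y : I, F (x, y) = u1 <-> (x = u1 \/ y = u1)].

(* One-sided, as it is only meant for commutative [F]. *)
Definition neutral_element (a : I) F : Prop := forall x : I, F (x, a) = x.

Definition I_GO_N N F : I * I -> I := fun p => N (F (p.1, N p.2)).

Definition I_G_N F N : I * I -> I := fun p => F (N p.1, p.2).

End FuzzyConnectives.

(* Main.v *)
Require Import Defs.
From mathcomp Require Import all_boot all_order all_algebra.
From mathcomp Require Import all_classical all_reals all_analysis.
Import numFieldNormedType.Exports.
Import Order.TTheory GRing.Theory Num.Theory.
Local Open Scope classical_set_scope.
Local Open Scope ring_scope.

(** Everything comes from reading the identity
    N (GO (x, N y)) = G (N' x, y) on the edges of the square.

    The edge y = 0 gives N (GO (x, 1)) = G (N' x, 0), and the edge x = 1 gives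
    N (GO (1, N y)) = G (0, y).  If 1 is neutral for GO, these become
    N x = G (N' x, 0) and N (N y) = G (0, y): the second says that N is an
    involution exactly when 0 is neutral for G, and the first then identifies
    N with N'.  If 0 is neutral for G, they become N (GO (x, 1)) = N' x and
    N (GO (1, N y)) = y; by commutativity of GO they combine into
    N' (N y) = y, so N' is a left inverse of N, and N' is an involution exactly
    when it equals N.

    For part (i), write the second argument of GO as N z.  A strict N is
    injective, so GO (x, N z) is 0 or 1 exactly when G (N' x, z) is 1 or 0, and
    the boundary conditions of the grouping function G, transported through N
    and the frontier negation N', are those of an overlap function.  That every
    point is of the form N z is the intermediate value theorem, which also
    serves in part (ii)(b). *)

Lemma uval_inj (R : realType) : injective (@uval R).
Proof. exact: val_inj. Qed.

Lemma uval_itv (R : realType) (x : unit_itv R) : 0 <= uval x <= 1.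
Proof. by have := set_valP x; rewrite /unit_itv /= in_itv. Qed.

(** The intermediate value theorem for functions of a real variable, applied to
    an extension f of N to the whole line.  The values of f off the unit
    interval do not matter, because the restriction sigL of f to the interval is
    N itself, and the continuity of that restriction is the continuity of f
    within the interval. *)
Lemma continuous_fuzzy_negation_surj {R : realType}
    {N : unit_itv R -> unit_itv R} :
  fuzzy_negation N -> continuous N -> forall y, exists x, N x = y.
Proof.
move=> [N0 N1 _] cN y.
pose f (r : R) : R := uval (N (insubd u0 r)).
have fE x : f (uval x) = uval (N x) by rewrite /f /uval /set_val /= valKd.
have cf : {within `[0, 1], continuous f}.
  apply/subspace_sigL_continuousP.
  have -> : sigL `[0, 1] f = @uval R \o N.
    by apply/funext => x; rewrite /sigL /= -fE.
  move=> x; apply: continuous_comp; first exact: cN.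
  exact: initial_continuous.
have f0 : f 0 = 1 by rewrite -[0]/(uval u0) fE N0.
have f1 : f 1 = 0 by rewrite -[1]/(uval u1) fE N1.
have yf : Num.min (f 0) (f 1) <= uval y <= Num.max (f 0) (f 1).
  by rewrite f0 f1 min_r ?ler01// max_l ?ler01// uval_itv.
have [c c01 fc] := IVT ler01 cf yf.
have cI : c \in unit_itv R by rewrite inE.
by exists (SigSub cI); apply: uval_inj; rewrite -fE.
Qed.

Lemma strict_negation_inj {R : realType} {N : unit_itv R -> unit_itv R} :
  strict_negation N -> injective N.
Proof.
move=> [_ Nlt] x y Nxy; apply: uval_inj.
by case: (ltgtP (uval x) (uval y)) => // /Nlt; rewrite Nxy ltxx.
Qed.

Lemma u0_neq_u1 (R : realType) : @u0 R <> u1.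
Proof. by move=> /(congr1 (@uval R))/esym/eqP; rewrite /uval /= oner_eq0. Qed.

Lemma frontier_negation_eq1 {R : realType} {N : unit_itv R -> unit_itv R} :
  fuzzy_negation N -> frontier_negation N -> forall x, N x = u1 <-> x = u0.
Proof.
move=> [N0 N1 _] fN x; split => [Nx|->//].
have [//|x1] := (fN x).1 (or_intror Nx).
by case: (@u0_neq_u1 R); rewrite -Nx x1 N1.
Qed.

Lemma frontier_negation_eq0 {R : realType} {N : unit_itv R -> unit_itv R} :
  fuzzy_negation N -> frontier_negation N -> forall x, N x = u0 <-> x = u1.
Proof.
move=> [N0 N1 _] fN x; split => [Nx|->//].
have [x0|//] := (fN x).1 (or_introl Nx).
by case: (@u0_neq_u1 R); rewrite -Nx x0 N0.
Qed.

(** Strictness of N lets N be cancelled and every second argument be written N z,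
    so that both boundary conditions of GO are read off those of G. *)
Lemma overlap_of_strict_frontier {R : realType}
    {N N' : unit_itv R -> unit_itv R}
    {GO G : unit_itv R * unit_itv R -> unit_itv R} :
  fuzzy_negation N -> fuzzy_negation N' -> general_overlap GO -> grouping G ->
  (forall x y, N (GO (x, N y)) = G (N' x, y)) ->
  strict_negation N -> frontier_negation N' -> overlap GO.
Proof.
move=> hN hN' [GOC _ _ GOincr cGO] [_ _ _ G0 G1] E sN fN'.
have Ninj := strict_negation_inj sN.
have [N0 N1 _] := hN.
have N_eq0 z : N z = u0 <-> z = u1.
  by split=> [Nz|->//]; apply: Ninj; rewrite N1.
have N_eq1 z : N z = u1 <-> z = u0.
  by split=> [Nz|->//]; apply: Ninj; rewrite N0.
split=> // x y; have [z <-] := continuous_fuzzy_negation_surj hN sN.1 y.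
- by rewrite -N_eq1 E G1 frontier_negation_eq1// N_eq0.
- by rewrite -N_eq0 E G0 frontier_negation_eq0// N_eq1.
Qed.

Theorem proposition19 (R : realType) (N N' : unit_itv R -> unit_itv R)
    (GO G : unit_itv R * unit_itv R -> unit_itv R)
    (hN : fuzzy_negation N) (hN' : fuzzy_negation N')
    (hGO : general_overlap GO) (hG : grouping G)
    (hI : I_GO_N N GO = I_G_N G N') :
  (* (i) *)
  (strict_negation N -> frontier_negation N' -> overlap GO) /\
  (* (ii) *)
  (neutral_element u1 GO ->
     (strong_negation N -> N = N') /\
     (continuous N -> N = N' -> strong_negation N) /\
     (strong_negation N <-> neutral_element u0 G)) /\
  (* (iii) *)
  (neutral_element u0 G ->
     (strong_negation N' <-> N' = N) /\
     (strong_negation N' <-> neutral_element u1 GO)).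
Proof.
have E x y : N (GO (x, N y)) = G (N' x, y) by have := congr1 (@^~ (x, y)) hI.
split; first exact: (overlap_of_strict_frontier hN hN' hGO hG E).
have [N0 _ _] := hN; have [_ N'1 _] := hN'.
have [GOC _ _ _ _] := hGO; have [GC _ _ _ _] := hG.
have edge_y0 x : N (GO (x, u1)) = G (N' x, u0) by rewrite -E N0.
have edge_x1 y : N (GO (N y, u1)) = G (y, u0) by rewrite GOC E N'1 GC.
split=> [GO1|G0].
- have NN y : N (N y) = G (y, u0) by rewrite -edge_x1 GO1.
  have strongN_iff : strong_negation N <-> neutral_element u0 G.
    by split=> h y; have := NN y; rewrite h.
  split; [|split=> //].
  + move=> /strongN_iff G0; apply/funext => x.
    by rewrite -[N x](congr1 N (GO1 x)) edge_y0 G0.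
  + move=> cN NN'; apply/strongN_iff => y.
    have [x <-] := continuous_fuzzy_negation_surj hN cN y.
    by rewrite {1}NN' -edge_y0 GO1.
- have N_GO x : N (GO (x, u1)) = N' x by rewrite edge_y0 G0.
  have N'N y : N' (N y) = y by rewrite -N_GO edge_x1 G0.
  have strongN'_iff : strong_negation N' <-> N' = N.
    split=> [sN'|eqN y]; last by rewrite {2}eqN N'N.
    by apply/funext => y; rewrite -[in LHS](N'N y) sN'.
  split=> //; split=> [/strongN'_iff eqN x|GO1].
  + by apply: (can_inj N'N); rewrite N_GO eqN.
  + by apply/strongN'_iff/funext => x; rewrite -N_GO GO1.
Qed.
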